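(* Let $c\in\mathbb{R}^n$, $A\in\mathbb{R}^{m\times n}$, $b\in\mathbb{R}^m$, $\rho>0$, and suppose the Lagrangian $L(x,y):=c^Tx+y^T(Ax-b)$ of the linear program $\min_{x\in\mathbb{R}^n}c^Tx$ subject to $Ax-b\le0$ has at least one saddle point on $\mathbb{R}^n\times\mathbb{R}^m_{\ge0}$. Let $$\hat L(x,\hat x,y,\hat y):=\frac{\rho}{2}\|x-\hat x\|^2+c^Tx+y^T(Ax-b)-\frac{\rho}{2}\|y-\hat y\|^2 .$$ Then the augmented primal-dual dynamics $$\dot x=-c-A^Ty-\rho(x-\hat x),\quad \dot{\hat x}=\rho(x-\hat x),\quad \dot y=[Ax-b-\rho(y-\hat y)]_y^+,\quad \dot{\hat y}=\rho(y-\hat y)$$ globally asymptotically converge to a saddle point $(x_\star,\hat x_\star,y_\star,\hat y_\star)$ of $\hat L$ (every trajectory, from any initial point with $y(0)\in\mathbb{R}^m_{\ge0}$, converges as $t\to\infty$ to some saddle point of $\hat L$), and $(x_\star,y_\star)$ is then a saddle point of $L$, i.e. an optimal primal-dual solution of the linear program.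
   Context: For $y\in\mathbb{R}^m_{\ge0}$ and $s\in\mathbb{R}^m$, $[s]_y^+$ is defined componentwise by $([s]_y^+)_j=s_j$ if $y_j>0$ and $([s]_y^+)_j=\max\{s_j,0\}$ if $y_j=0$. Saddle point of $L$: $L(x_\star,y)\le L(x_\star,y_\star)\le L(x,y_\star)$ for all $x\in\mathbb{R}^n$, $y\in\mathbb{R}^m_{\ge0}$. Saddle point of $\hat L$: $\hat L(x_\star,\hat x_\star,y,\hat y)\le\hat L(x_\star,\hat x_\star,y_\star,\hat y_\star)\le\hat L(x,\hat x,y_\star,\hat y_\star)$ for all $x,\hat x\in\mathbb{R}^n$, $y\in\mathbb{R}^m_{\ge0}$, $\hat y\in\mathbb{R}^m$. Solutions are in the Carathéodory sense (absolutely continuous, satisfying the equations for almost every $t$, with $y(t)\ge0$). *)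

(* Defs.v *)
From HB Require Import structures.
From mathcomp Require Import all_boot all_order all_algebra.
From mathcomp Require Import all_classical all_reals all_analysis.

Set Implicit Arguments.
Unset Strict Implicit.
Unset Printing Implicit Defensive.

Import Order.TTheory GRing.Theory Num.Theory.
Import numFieldNormedType.Exports.

Local Open Scope classical_set_scope.
Local Open Scope ring_scope.

(* u^T v.  The library norm `|u| on 'cV[R]_n is the sup norm, so the squared
   Euclidean norm is written dot u u. *)
Definition dot (R : realType) (n : nat) (u v : 'cV[R]_n) : R :=
  (u^T *m v) 0 0.

Definition nonneg (R : realType) (m : nat) (y : 'cV[R]_m) : Prop :=
  forall j, 0 <= y j 0.

Definition lagrangian (R : realType) (m n : nat) (c : 'cV[R]_n)
    (A : 'M[R]_(m, n)) (b : 'cV[R]_m) (x : 'cV[R]_n) (y : 'cV[R]_m) : R :=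
  dot c x + dot y (A *m x - b).

Definition aug_lagrangian (R : realType) (m n : nat) (c : 'cV[R]_n)
    (A : 'M[R]_(m, n)) (b : 'cV[R]_m) (rho : R)
    (x xh : 'cV[R]_n) (y yh : 'cV[R]_m) : R :=
  rho / 2 * dot (x - xh) (x - xh) + dot c x + dot y (A *m x - b)
  - rho / 2 * dot (y - yh) (y - yh).

Definition saddle_point (R : realType) (m n : nat)
    (L : 'cV[R]_n -> 'cV[R]_m -> R) (xs : 'cV[R]_n) (ys : 'cV[R]_m) : Prop :=
  nonneg ys /\
  forall (x : 'cV[R]_n) (y : 'cV[R]_m), nonneg y ->
    L xs y <= L xs ys /\ L xs ys <= L x ys.

(* Only y is sign-constrained; the auxiliary variable yh ranges over R^m. *)
Definition aug_saddle_point (R : realType) (m n : nat)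
    (Lh : 'cV[R]_n -> 'cV[R]_n -> 'cV[R]_m -> 'cV[R]_m -> R)
    (xs xhs : 'cV[R]_n) (ys yhs : 'cV[R]_m) : Prop :=
  nonneg ys /\
  forall (x xh : 'cV[R]_n) (y yh : 'cV[R]_m), nonneg y ->
    Lh xs xhs y yh <= Lh xs xhs ys yhs /\ Lh xs xhs ys yhs <= Lh x xh ys yhs.

(* Primal: min c^T x subject to A x - b <= 0. *)
Definition primal_feasible (R : realType) (m n : nat)
    (A : 'M[R]_(m, n)) (b : 'cV[R]_m) (x : 'cV[R]_n) : Prop :=
  forall i, (A *m x - b) i 0 <= 0.

Definition primal_optimal (R : realType) (m n : nat) (c : 'cV[R]_n)
    (A : 'M[R]_(m, n)) (b : 'cV[R]_m) (xs : 'cV[R]_n) : Prop :=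
  primal_feasible A b xs /\
  forall x, primal_feasible A b x -> dot c xs <= dot c x.

(* Dual: max - b^T y subject to A^T y + c = 0 and y >= 0. *)
Definition dual_feasible (R : realType) (m n : nat) (c : 'cV[R]_n)
    (A : 'M[R]_(m, n)) (y : 'cV[R]_m) : Prop :=
  nonneg y /\ A^T *m y + c = 0.

Definition dual_optimal (R : realType) (m n : nat) (c : 'cV[R]_n)
    (A : 'M[R]_(m, n)) (b : 'cV[R]_m) (ys : 'cV[R]_m) : Prop :=
  dual_feasible c A ys /\
  forall y, dual_feasible c A y -> - dot b y <= - dot b ys.

(* [s]_y^+, used only for nonneg y. *)
Definition proj_pos (R : realType) (m : nat) (y s : 'cV[R]_m) : 'cV[R]_m :=
  \col_j (if 0 < y j 0 then s j 0 else Num.max (s j 0) 0).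

Definition abs_continuous (R : realType) (V : normedModType R)
    (a b : R) (f : R -> V) : Prop :=
  forall e : R, 0 < e -> exists2 d : R, 0 < d &
    forall (k : nat) (u v : 'I_k -> R),
      (forall i, a <= u i /\ u i <= v i /\ v i <= b) ->
      trivIset setT (fun i => [set t | u i < t < v i]) ->
      \sum_(i < k) (v i - u i) < d ->
      \sum_(i < k) `|f (v i) - f (u i)| < e.

(* Caratheodory solutions on [0, +oo): the values at negative times are
   irrelevant, and absolute continuity is required on compact intervals. *)
Definition apd_solution (R : realType) (m n : nat) (c : 'cV[R]_n)
    (A : 'M[R]_(m, n)) (b : 'cV[R]_m) (rho : R)
    (x xh : R -> 'cV[R]_n) (y yh : R -> 'cV[R]_m) : Prop :=
  [/\ forall T : R, 0 < T ->
        [/\ abs_continuous 0 T x, abs_continuous 0 T xh,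
            abs_continuous 0 T y & abs_continuous 0 T yh],
      forall t : R, 0 <= t -> nonneg (y t) &
      {ae @lebesgue_measure R, forall t : R, 0 < t ->
        [/\ is_derive t 1 x (- c - A^T *m y t - rho *: (x t - xh t)),
            is_derive t 1 xh (rho *: (x t - xh t)),
            is_derive t 1 y
              (proj_pos (y t) (A *m x t - b - rho *: (y t - yh t))) &
            is_derive t 1 yh (rho *: (y t - yh t))]}].

(* Main.v *)
Require Import Defs.
From HB Require Import structures.
From mathcomp Require Import all_boot all_order all_algebra.
From mathcomp Require Import all_classical all_reals all_analysis.

From mathcomp Require Import ring lra.

Set Implicit Arguments.
Unset Strict Implicit.
Unset Printing Implicit Defensive.

From mathcomp Require Import ring lra.

Set Implicit Arguments.
Unset Strict Implicit.
Unset Printing Implicit Defensive.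

From mathcomp Require Import ring lra.

Set Implicit Arguments.
Unset Strict Implicit.
Unset Printing Implicit Defensive.

Import Order.TTheory GRing.Theory Num.Theory.
Import numFieldNormedType.Exports.

Local Open Scope classical_set_scope.
Local Open Scope ring_scope.

(* Along a trajectory the squared distance V to any saddle point dissipates at
   least 2 rho (|x - xh|^2 + |y - yh|^2).  Hence the trajectory is bounded and, by
   Barbalat's argument, x - xh and y - yh tend to 0.  Then xh' and yh' tend to 0,
   so on windows [t, t+1] around a limit point the trajectory is almost constant:
   integrating the equations for x and y over such windows forces the limit
   point to satisfy the KKT conditions, which avoids the invariance of limit
   sets used in LaSalle's principle.  Taking that limit point as reference in V,
   which is nonincreasing and small at arbitrarily late times, gives
   convergence. *)

(** * Growth of absolutely continuous functions under an almost everywhere derivative bound *)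

Section GrowthLemma.
Variable R : realType.
Implicit Types (f g : R -> R) (a b k t u v w : R).

(** Completeness of the reals stands in for a finite subcover: the supremum of the points reachable
    from [a] is itself reachable, and the local hypothesis at that supremum reaches further unless
    it equals [b]. Only intervals containing their tag are asked for, as in gauge partitions. *)
Lemma cousin (P : R -> R -> Prop) a b : a <= b ->
  (forall u v w, u <= v -> v <= w -> P u v -> P v w -> P u w) ->
  (forall t, a <= t -> t <= b -> exists2 d, 0 < d & forall u v,
     a <= u -> v <= b -> t - d < u -> u <= t -> t <= v -> v < t + d -> P u v) ->
  P a b.
Proof.
move=> ab Pcat Ploc.
pose S := [set t | a <= t /\ t <= b /\ P a t].
have Sa : S a.
  have [d d0 Pd] := Ploc a (lexx a) ab.
  by split=> //; split=> //; apply: Pd => //; lra.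
have Sub : ubound S b by move=> t [_ []].
have Ssup : has_sup S by split; [exists a | exists b].
have as_ : a <= sup S by apply: ub_le_sup => //; exists b.
have sb : sup S <= b by apply: ge_sup => //; exists a.
have [d d0 Pd] := Ploc _ as_ sb.
have [t [at_ [tb Pat]] st] := sup_adherent d0 Ssup.
have ts : t <= sup S by apply: ub_le_sup; [exists b | split].
(* A candidate strictly beyond the supremum, capped at [b]; since it is reachable, the cap must be
   active. *)
pose v := Num.min b (sup S + d / 2).
have vb : v <= b by rewrite /v ge_min lexx.
have vd : v <= sup S + d / 2 by rewrite /v ge_min lexx orbT.
have sv : sup S <= v by rewrite /v le_min sb/=; lra.
have Sv : S v.
  split; first exact: le_trans sv.
  split=> //; apply: (Pcat a t v) => //; first exact: le_trans sv.
  by apply: Pd => //; lra.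
have vs : v <= sup S by apply: ub_le_sup => //; exists b.
suff -> : b = v by case: Sv => _ [].
by rewrite /v; case: (leP b (sup S + d / 2)) => // bd; move: vs; rewrite /v min_r; lra.
Qed.

Lemma is_derive_taylor1 f t d e : is_derive t 1 f d -> 0 < e ->
  exists2 r, 0 < r & forall v, `|v - t| < r ->
    `|f v - f t - d * (v - t)| <= e * `|v - t|.
Proof.
move=> [/cvg_ex[/= l fl] fd] e0.
have ld : l = d by rewrite -fd; apply/esym/cvg_lim.
move/cvgrPdist_le : fl => /(_ _ e0)[/= r r0 rle].
exists r => // v vr; have [->|vt] := eqVneq v t.
  by rewrite !subrr mulr0 subr0 normr0 mulr0.
have vt0 : v - t != 0 by rewrite subr_eq0.
have := rle (v - t); rewrite /ball_/= sub0r normrN => /(_ vr vt0).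
rewrite [_ *: 1]mulr1 subrK ld => H.
have -> : f v - f t - d * (v - t) = - (d - (v - t)^-1 * (f v - f t)) * (v - t).
  by field.
by rewrite normrM normrN ler_wpM2r.
Qed.

Fixpoint interval_chain u (s : seq (R * R)) v : Prop :=
  match s with
  | nil => u <= v
  | p :: s' => [/\ u <= p.1, p.1 <= p.2 & interval_chain p.2 s' v]
  end.

Lemma interval_chain_le u s v : interval_chain u s v -> u <= v.
Proof.
elim: s u => //= p s IH u [up p12 /IH]; exact/le_trans/(le_trans up).
Qed.

Lemma interval_chain_cat u s v s' w :
  interval_chain u s v -> interval_chain v s' w -> interval_chain u (s ++ s') w.
Proof.
elim: s u => /= [|p s IH] u; last by move=> [? ? /IH H] /H.
case: s' => [|q s'] /=; first exact: le_trans.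
by move=> uv [vq ? ?]; split=> //; apply: le_trans vq.
Qed.

Lemma interval_chain_nth (p0 : R * R) u s v : interval_chain u s v ->
  forall i, (i < size s)%N ->
  [/\ u <= (nth p0 s i).1, (nth p0 s i).1 <= (nth p0 s i).2, (nth p0 s i).2 <= v &
   forall j, (j < i)%N -> (nth p0 s j).2 <= (nth p0 s i).1].
Proof.
elim: s u => //= p s IH u [up p12 ch] [|i] /= ilt.
  by split=> //; exact: interval_chain_le ch.
have [h1 h2 h3 h4] := IH _ ch i ilt; split=> //.
  exact/(le_trans up)/(le_trans p12).
by case=> //= j ji; exact: h4.
Qed.

Lemma interval_chain_trivIset u s v (p0 : R * R) : interval_chain u s v ->
  trivIset setT (fun i : 'I_(size s) =>
    [set t | (nth p0 s i).1 < t < (nth p0 s i).2]).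
Proof.
move=> ch; apply/trivIsetP => i j _ _ ij; rewrite -subset0 => t [/= /andP[h1 h2] /andP[h3 h4]].
wlog ilj : i j ij h1 h2 h3 h4 / (i < j)%N => [W|].
  have := ij; rewrite neq_ltn => /orP[|] h; first exact: (W i j).
  by apply: (W j i) => //; rewrite eq_sym.
have [_ _ _ /(_ i ilj)] := interval_chain_nth p0 ch (ltn_ord j).
lra.
Qed.

Lemma interval_chain_measure u s v (p0 : R * R) (U : set R) :
  measurable U -> interval_chain u s v ->
  (forall i, (i < size s)%N -> `](nth p0 s i).1, (nth p0 s i).2[ `<=` U) ->
  ((\sum_(i < size s) ((nth p0 s i).2 - (nth p0 s i).1))%:E <= lebesgue_measure U)%E.
Proof.
move=> mU ch sU; have tI := interval_chain_trivIset (p0 := p0) ch.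
pose F (i : 'I_(size s)) : set R := `](nth p0 s i).1, (nth p0 s i).2[%classic.
have FE i : F i = [set t | (nth p0 s i).1 < t < (nth p0 s i).2].
  by apply/seteqP; split => t /=; rewrite /F/= in_itv.
have tF : trivIset setT F by rewrite (funext FE).
have mF i : measurable (F i) by exact: measurable_itv.
have := measure_bigsetU_ord (@lebesgue_measure R) xpredT mF tF.
have -> : (\sum_(i < size s) lebesgue_measure (F i))%E =
    (\sum_(i < size s) ((nth p0 s i).2 - (nth p0 s i).1))%:E.
  rewrite -sumEFin; apply: eq_bigr => i _.
  have [_ + _ _] := interval_chain_nth p0 ch (ltn_ord i).
  rewrite /F lebesgue_measure_itv /= lte_fin le_eqVlt => /orP[/eqP->|->//].
  by rewrite ltxx subrr.
move=> <-; apply: le_measure; rewrite ?inE//.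
  by apply: bigsetU_measurable => i _; exact: mF.
by elim/big_ind : _ => // [A B AU BU|i _]; [rewrite subUset | exact: sU].
Qed.

(** Outer regularity applied to a measurable null superset of [N]. *)
Lemma negligible_open_cover (N : set R) d : (@lebesgue_measure R).-negligible N ->
  0 < d -> exists2 U : set R, open U & N `<=` U /\ (lebesgue_measure U < d%:E)%E.
Proof.
move=> [B [mB B0 NB]] d0.
have Bfin : (lebesgue_measure B < +oo)%E by rewrite [ltLHS]B0 ltry.
have [U [oU BU mU]] := lebesgue_regularity_outer mB Bfin d0.
exists U => //; split; first exact: subset_trans BU.
have mU' : measurable U by exact: measurable_realfun.open_measurable.
have := measureDI (@lebesgue_measure R) mU' mB.
by rewrite setIidr// [X in (_ + X)%E]B0 adde0 => ->.
Qed.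

(* Cousin's lemma supplies a partition whose pieces either satisfy the first
   order estimate at a good tag, or lie in a small open neighbourhood of the
   exceptional null set; the latter contribute little by absolute continuity. *)
Lemma abs_continuous_growth f a b k : a <= b -> abs_continuous a b f ->
  {ae @lebesgue_measure R, forall t, a < t -> t < b ->
     exists2 d, is_derive t 1 f d & d <= k} ->
  f b - f a <= k * (b - a).
Proof.
move=> ab ACf [B [mB B0 NB]]; rewrite leNgt; apply/negP => gap.
(* The total error will be below [e * (b - a) + 2 * e], so dividing the excess growth by [b - a + 3]
   yields a contradiction. *)
pose e := (f b - f a - k * (b - a)) / (b - a + 3).
have e0 : 0 < e by rewrite divr_gt0//; lra.
have [d' d'0 ACd] := ACf e e0.
(* The first bound makes the increments of [f] over the bad pieces sum to less than [e]; the second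
   does the same for [|k|] times their total length. *)
pose d := Num.min d' (e / (`|k| + 1)).
have k1 : 0 < `|k| + 1 by rewrite ltr_pwDr.
have d0 : 0 < d by rewrite lt_min d'0 divr_gt0.
(* The derivative is controlled only in the open interval, so the endpoints join the null set. *)
pose N := B `|` ([set a] `|` [set b]).
have Nneg : (@lebesgue_measure R).-negligible N.
  have neg1 (x : R) : (@lebesgue_measure R).-negligible [set x].
    by exists [set x]; split => //; exact: lebesgue_measure_set1.
  apply: negligibleU; first by exists B; split.
  by apply: negligibleU; exact: neg1.
have [U oU [NU Ud]] := negligible_open_cover Nneg d0.
(* Growth at rate [k + e], up to a correction from bad pieces whose interiors lie in [U]. Both terms
   add up under concatenation. *)
pose P u v := u <= v /\ exists s, [/\ interval_chain u s v,
  forall p, p \in s -> `]p.1, p.2[ `<=` U &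
  f v - f u <= (k + e) * (v - u) + \sum_(p <- s) (`|f p.2 - f p.1| + `|k| * (p.2 - p.1))].
have [_ [s [ch sU fs]]] : P a b.
  apply: cousin => //.
    move=> u v w uv vw [_ [s1 [c1 U1 f1]]] [_ [s2 [c2 U2 f2]]].
    split; first exact: le_trans vw.
    exists (s1 ++ s2); split; first exact: interval_chain_cat c2.
      by move=> p; rewrite mem_cat => /orP[/U1|/U2].
    rewrite big_cat/=; nra.
  move=> t at_ tb; have [Nt|Nt] := pselect (N t).
    have /nbhs_ballP[r r0 rU] : nbhs t U by apply: open_nbhs_nbhs; split=> //; exact: NU.
    exists r => // u v _ _ ru ut tv vr; split; first exact: le_trans tv.
    exists [:: (u, v)]; split => //=.
    + by split=> //; exact: le_trans tv.
    + move=> p; rewrite inE => /eqP -> z /=; rewrite in_itv/= => /andP[uz zv].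
      by apply: rU; rewrite /ball/= ltr_distl; lra.
    (* The term with [|k|] compensates a negative [k], so a bad piece meets the bound whatever [f]
       does on it. *)
    + rewrite big_seq1/=.
      have := ler_norm (f v - f u); have := ler_norm (- k); rewrite normrN; nra.
  have [d1 fd d1k] : exists2 d, is_derive t 1 f d & d <= k.
    apply: contrapT => H; apply: Nt.
    have [ta|ta] := eqVneq t a; first by right; left.
    have [tb'|tb'] := eqVneq t b; first by right; right.
    left; apply: NB => /= H'; apply: H; apply: H'.
      by rewrite lt_neqAle eq_sym ta.
    by rewrite lt_neqAle tb'.
  (* The tag lies between [u] and [v], so the two first order errors add up to at most
     [e * (v - u)]. *)
  have [r r0 rf] := is_derive_taylor1 fd e0.
  exists r => // u v _ _ ru ut tv vr; split; first exact: le_trans tv.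
  exists nil; split => //=; first exact: le_trans tv.
  rewrite big_nil addr0.
  have nv : `|v - t| = v - t by rewrite ger0_norm//; lra.
  have nu : `|u - t| = t - u by rewrite ler0_norm ?opprB//; lra.
  have := rf v; have := rf u; rewrite nu nv.
  move=> /(_ ltac:(lra)); rewrite ler_norml => /andP[h1 _].
  move=> /(_ ltac:(lra)); rewrite ler_norml => /andP[_ h2].
  nra.
have sizeU : (forall i, (i < size s)%N ->
    `](nth (a, a) s i).1, (nth (a, a) s i).2[ `<=` U).
  by move=> i si; apply: sU; exact: mem_nth.
have chn := interval_chain_nth (a, a) ch.
have mU : measurable U by exact: measurable_realfun.open_measurable.
have := interval_chain_measure mU ch sizeU.
move=> /le_lt_trans/(_ Ud); rewrite lte_fin lt_min => /andP[sd' sk].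
have := ACd (size s) (fun i => (nth (a, a) s i).1) (fun i => (nth (a, a) s i).2).
have H1 : forall i : 'I_(size s), a <= (nth (a, a) s i).1 /\
   (nth (a, a) s i).1 <= (nth (a, a) s i).2 /\ (nth (a, a) s i).2 <= b.
  by move=> i; have [] := chn _ (ltn_ord i).
move=> /(_ H1 (interval_chain_trivIset ch) sd') se.
move: fs; rewrite (big_nth (a, a)) big_mkord big_split/= -mulr_sumr.
set S1 := \sum_(i < _) _ in se *; set S2 := \sum_(i < _) _ in sd' sk *.
move=> fs.
have : `|k| * S2 <= e.
  move: sk; rewrite ltr_pdivlMr// => sk.
  have S20 : 0 <= S2 by apply: sumr_ge0 => i _; have := H1 i; lra.
  nra.
have : e * (b - a + 3) = f b - f a - k * (b - a) by rewrite /e; field; lra.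
nra.
Qed.
End GrowthLemma.

(** * Euclidean inner product and the projection onto the nonnegative orthant *)

Section EuclideanProduct.
Variable R : realType.

Lemma dotE n (u v : 'cV[R]_n) : dot u v = \sum_i u i 0 * v i 0.
Proof. by rewrite /dot mxE; apply: eq_bigr => i _; rewrite mxE. Qed.

Lemma dotC k (u v : 'cV[R]_k) : dot u v = dot v u.
Proof. by rewrite !dotE; apply: eq_bigr => i _; rewrite mulrC. Qed.

Lemma dotDl k (u v w : 'cV[R]_k) : dot (u + v) w = dot u w + dot v w.
Proof. by rewrite /dot linearD mulmxDl mxE. Qed.

Lemma dotNl k (u w : 'cV[R]_k) : dot (- u) w = - dot u w.
Proof. by rewrite /dot linearN mulNmx mxE. Qed.

Lemma dotDr k (u v w : 'cV[R]_k) : dot w (u + v) = dot w u + dot w v.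
Proof. by rewrite ![dot w _]dotC dotDl. Qed.

Lemma dotNr k (u w : 'cV[R]_k) : dot w (- u) = - dot w u.
Proof. by rewrite ![dot w _]dotC dotNl. Qed.

Lemma dotZr k a (u w : 'cV[R]_k) : dot w (a *: u) = a * dot w u.
Proof. by rewrite /dot -scalemxAr mxE. Qed.

Lemma dot0l k (w : 'cV[R]_k) : dot 0 w = 0.
Proof. by rewrite /dot trmx0 mul0mx mxE. Qed.

Lemma dot_ge0 k (u : 'cV[R]_k) : 0 <= dot u u.
Proof. by rewrite dotE; apply: sumr_ge0 => i _; rewrite -expr2 sqr_ge0. Qed.

Lemma sqr_coord_le_dot k (u : 'cV[R]_k) i : u i 0 ^+ 2 <= dot u u.
Proof.
rewrite dotE (bigD1 i)//= expr2 lerDl.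
by apply: sumr_ge0 => j _; rewrite -expr2 sqr_ge0.
Qed.

Lemma dot_le0_eq0 k (u : 'cV[R]_k) : dot u u <= 0 -> u = 0.
Proof.
move=> u0; apply/colP => i; rewrite mxE; apply/eqP; rewrite -sqrf_eq0 eq_le sqr_ge0 andbT.
exact: le_trans (sqr_coord_le_dot u i) u0.
Qed.

Lemma dot_mulmx m n (A : 'M[R]_(m, n)) (x : 'cV[R]_n) (y : 'cV[R]_m) :
  dot y (A *m x) = dot (A^T *m y) x.
Proof. by rewrite /dot trmx_mul trmxK mulmxA. Qed.

Lemma dot_le_sqr_norm k (u : 'cV[R]_k) e : 0 <= e -> dot u u <= e ^+ 2 -> `|u| <= e.
Proof.
move=> e0 ue; rewrite [leLHS]/Num.Def.normr/= mx_normrE.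
apply: bigmax_le => // -[i j] _ /=; rewrite (ord1 j).
rewrite -ler_sqr ?nnegrE// real_normK ?num_real//.
exact: le_trans (sqr_coord_le_dot u i) ue.
Qed.

(** Coordinates with [y_j > 0] agree; where [y_j = 0] the factor is [- q_j <= 0] and projecting can
    only increase [s_j]. This lets the dissipation estimate drop the projection. *)
Lemma dot_proj_pos_le k (y q s : 'cV[R]_k) : nonneg y -> nonneg q ->
  dot (y - q) (proj_pos y s) <= dot (y - q) s.
Proof.
move=> y0 q0; rewrite !dotE; apply: ler_sum => j _; rewrite !mxE.
case: ltP => // yj; have -> : y j 0 = 0 by apply/le_anti; rewrite yj y0.
have := q0 j; case: (leP (s j 0) 0); nra.
Qed.

Lemma norm_proj_pos_le k (z s : 'cV[R]_k) i : `|proj_pos z s i 0| <= `|s i 0|.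
Proof.
rewrite mxE; case: ifP => // _.
by case: (leP (s i 0) 0) => // _; rewrite normr0.
Qed.

End EuclideanProduct.

(** * Closure properties of absolute continuity and derivatives of squared distances *)

Section AbsContinuous.
Variable R : realType.
Implicit Types (a b K : R).

(** A domination principle from which sums, opposites, coordinates and products follow; unary
    operations use the same function for [f] and [g]. *)
Lemma abs_continuous_le (V1 V2 V : normedModType R) (f : R -> V1) (g : R -> V2)
    (h : R -> V) a b K : 0 <= K ->
  (forall u v, a <= u -> u <= v -> v <= b ->
     `|h v - h u| <= K * (`|f v - f u| + `|g v - g u|)) ->
  abs_continuous a b f -> abs_continuous a b g -> abs_continuous a b h.
Proof.
move=> K0 hfg ACf ACg e e0.
(* Dividing by [K + 1] covers [K = 0] and keeps the final inequality strict. *)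
have e'0 : 0 < e / (2 * (K + 1)) by rewrite divr_gt0//; lra.
have [d1 d10 Hf] := ACf _ e'0; have [d2 d20 Hg] := ACg _ e'0.
exists (Num.min d1 d2); first by rewrite lt_min d10.
move=> k u v uv tI; rewrite lt_min => /andP[/(Hf _ _ _ uv tI) sf /(Hg _ _ _ uv tI) sg].
have le1 : \sum_(i < k) `|h (v i) - h (u i)| <=
   K * (\sum_(i < k) `|f (v i) - f (u i)| + \sum_(i < k) `|g (v i) - g (u i)|).
  rewrite -big_split/= mulr_sumr; apply: ler_sum => i _.
  by have [? [? ?]] := uv i; exact: hfg.
apply: (le_lt_trans le1); apply: (@le_lt_trans _ _ (K * (e / (K + 1)))).
  rewrite ler_wpM2l//; have -> : e / (K + 1) = e / (2 * (K + 1)) + e / (2 * (K + 1)).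
    by field; lra.
  by rewrite lerD// ltW.
rewrite mulrA ltr_pdivrMr; nra.
Qed.

Lemma abs_continuous_subinterval (V : normedModType R) (f : R -> V) a b a' b' :
  a <= a' -> b' <= b -> abs_continuous a b f -> abs_continuous a' b' f.
Proof.
move=> aa' bb' ACf e /ACf[d d0 H]; exists d => // k u v uv.
by apply: H => i; have [? [? ?]] := uv i; split; [|split]; lra.
Qed.

Lemma abs_continuous_cst (V : normedModType R) (p : V) a b :
  abs_continuous a b (fun=> p).
Proof.
move=> e e0; exists 1 => // k u v _ _ _.
by rewrite big1// => i _; rewrite subrr normr0.
Qed.

Lemma abs_continuousD (V : normedModType R) (f g : R -> V) a b :
  abs_continuous a b f -> abs_continuous a b g ->
  abs_continuous a b (fun t => f t + g t).
Proof.
apply: (@abs_continuous_le _ _ _ _ _ _ _ _ 1) => // u v _ _ _.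
by rewrite mul1r opprD addrACA; exact: ler_normD.
Qed.

Lemma abs_continuousN (V : normedModType R) (f : R -> V) a b :
  abs_continuous a b f -> abs_continuous a b (fun t => - f t).
Proof.
move=> ACf; apply: (@abs_continuous_le _ _ _ f f _ _ _ 1) => // u v _ _ _.
by rewrite -opprD normrN mul1r lerDl.
Qed.

Lemma abs_continuous_sum (V : normedModType R) n (f : 'I_n -> R -> V) a b :
  (forall i, abs_continuous a b (f i)) ->
  abs_continuous a b (fun t => \sum_(i < n) f i t).
Proof.
move=> ACf; elim: n f ACf => [|n IH] f ACf.
  under eq_fun do rewrite big_ord0.
  exact: abs_continuous_cst.
under eq_fun do rewrite big_ord_recr/=.
apply: (@abs_continuousD _ (fun t => \sum_(i < n) f (widen_ord (leqnSn n) i) t)) => //.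
exact: (IH (fun i => f (widen_ord (leqnSn n) i))).
Qed.

Lemma abs_continuous_coord m n (f : R -> 'M[R]_(m, n)) a b i j :
  abs_continuous a b f -> abs_continuous a b (fun t => f t i j).
Proof.
move=> ACf; apply: (@abs_continuous_le _ _ _ f f _ _ _ 1) => // u v _ _ _.
rewrite mul1r (@le_trans _ _ `|f v - f u|)// ?lerDl//.
rewrite [leRHS]/Num.Def.normr/= mx_normrE.
by under eq_bigr do rewrite !mxE; exact: (le_bigmax _ _ (i, j)).
Qed.

(** The definition with a single interval gives oscillation below 1 at a uniform scale; [cousin]
    glues the local bounds, bounds of adjacent intervals being added. *)
Lemma abs_continuous_bounded (f : R -> R) a b : a <= b -> abs_continuous a b f ->
  exists2 M, 0 <= M & forall t, a <= t -> t <= b -> `|f t| <= M.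
Proof.
move=> ab ACf.
have [d d0 ACd] := ACf 1 ltr01.
have close u v : a <= u -> u <= v -> v <= b -> v - u < d -> `|f v - f u| < 1.
  move=> au uv vb vud; have := ACd 1%N (fun=> u) (fun=> v).
  by rewrite !big_ord1; apply => // i j _ _ _; rewrite !ord1.
apply: (@cousin _ (fun u v => exists2 M, 0 <= M &
  forall t, u <= t -> t <= v -> `|f t| <= M)) => //.
  move=> u v w uv vw [M1 M10 H1] [M2 M20 H2]; exists (M1 + M2); first exact: addr_ge0.
  move=> t ut tw; have [tv|vt] := leP t v.
    by rewrite (le_trans (H1 _ ut tv))// lerDl.
  by rewrite (le_trans (H2 _ (ltW vt) tw))// lerDr.
move=> t at_ tb; exists d => // u v au vb du ut tv vd.
exists (`|f t| + 1); first exact: addr_ge0.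
move=> s us sv; rewrite -lerBlDl (le_trans (lerB_dist _ _))//.
have [st|ts] := leP s t.
  by rewrite distrC ltW// close//; lra.
by rewrite ltW// close//; lra.
Qed.

Lemma abs_continuousM (f g : R -> R) a b : a <= b ->
  abs_continuous a b f -> abs_continuous a b g ->
  abs_continuous a b (fun t => f t * g t).
Proof.
move=> ab ACf ACg.
have [M M0 fM] := abs_continuous_bounded ab ACf.
have [N N0 gN] := abs_continuous_bounded ab ACg.
apply: (@abs_continuous_le _ _ _ f g _ _ _ (M + N)) => //; first exact: addr_ge0.
move=> u v au uv vb.
have -> : f v * g v - f u * g u = (f v - f u) * g v + f u * (g v - g u) by ring.
apply: le_trans (ler_normD _ _) _; rewrite !normrM.
have := fM u au (le_trans uv vb); have := gN v (le_trans au uv) vb.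
have := normr_ge0 (f v - f u); have := normr_ge0 (g v - g u); nra.
Qed.

Lemma abs_continuous_dist_sqr n (x : R -> 'cV[R]_n) (p : 'cV[R]_n) a b : a <= b ->
  abs_continuous a b x -> abs_continuous a b (fun t => dot (x t - p) (x t - p)).
Proof.
move=> ab ACx; under eq_fun do rewrite dotE.
apply: (@abs_continuous_sum _ _ (fun i t => (x t - p) i 0 * (x t - p) i 0)) => i.
have ACi : abs_continuous a b (fun t => (x t - p) i 0).
  apply: abs_continuous_coord; apply: abs_continuousD => //.
  exact: abs_continuous_cst.
exact: abs_continuousM.
Qed.

Lemma is_derive_coord m n (f : R -> 'M[R]_(m, n)) (t : R) D i j :
  is_derive t 1 f D -> is_derive t 1 (fun s => f s i j) (D i j).
Proof.
move=> [df <-]; split; first by move/derivable_mxP : df; exact.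
by rewrite derive_mx// mxE.
Qed.

Lemma is_derive_dist_sqr n (x : R -> 'cV[R]_n) (p : 'cV[R]_n) (t : R) D :
  is_derive t 1 x D ->
  is_derive t 1 (fun s => dot (x s - p) (x s - p)) (2 * dot (x t - p) D).
Proof.
move=> xD.
have -> : (fun s => dot (x s - p) (x s - p)) =
    \sum_(i < n) (fun s => (x s i 0 - p i 0) ^+ 2).
  by apply/funext => s; rewrite fct_sumE dotE; apply: eq_bigr => i _; rewrite !mxE expr2.
have -> : 2 * dot (x t - p) D = \sum_(i < n) (2 * (x t i 0 - p i 0) * D i 0).
  by rewrite dotE mulr_sumr; apply: eq_bigr => i _; rewrite !mxE mulrA.
apply: is_derive_sum => i; have xi := is_derive_coord i 0 xD.
apply: is_derive_eq.
by rewrite /GRing.scale/= subr0; ring.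
Qed.

End AbsContinuous.

(** * Growth on the half line, Barbalat's argument, and limits along unit windows *)

Section Asymptotics.
Variable R : realType.
Implicit Types (f g d V : R -> R) (k s t l e : R).

Global Instance ae_lebesgue_filter :
  Filter (nbhs (almost_everywhere (@lebesgue_measure R))).
Proof. exact: (ae_filter_ringOfSetsType (@lebesgue_measure R)). Qed.

Lemma ae_growth_le f k s t : 0 <= s -> s <= t ->
  (forall T, 0 < T -> abs_continuous 0 T f) ->
  {ae @lebesgue_measure R, forall r, s < r -> r < t ->
     exists2 v, is_derive r 1 f v & v <= k} ->
  f t - f s <= k * (t - s).
Proof.
move=> s0 st ACf; apply: abs_continuous_growth => //.
(* [t] may be 0, whereas absolute continuity is assumed on [[0, T]] with [T > 0]. *)
have : 0 < t + 1 by lra.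
by move=> /ACf; apply: abs_continuous_subinterval => //; lra.
Qed.

Lemma ae_growth_ge f k s t : 0 <= s -> s <= t ->
  (forall T, 0 < T -> abs_continuous 0 T f) ->
  {ae @lebesgue_measure R, forall r, s < r -> r < t ->
     exists2 v, is_derive r 1 f v & k <= v} ->
  k * (t - s) <= f t - f s.
Proof.
move=> s0 st ACf df; rewrite -lerN2 -mulNr opprB addrC -[f s]opprK.
apply: (@ae_growth_le (fun r => - f r)) => //.
  by move=> T /ACf; exact: abs_continuousN.
apply: filterS df => r df sr rt; have [v fv kv] := df sr rt.
by exists (- v); [exact: is_deriveN | rewrite lerN2].
Qed.

(** Since [d] is Lipschitz, a value of size [e] stays above [e / 2] for a fixed duration, during
    which [V] loses a fixed amount. That is impossible once [V] is within this amount of its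
    infimum. *)
Lemma barbalat V d (rho K : R) : 0 < rho ->
  (forall T, 0 < T -> abs_continuous 0 T V) ->
  (forall T, 0 < T -> abs_continuous 0 T d) ->
  (forall t, 0 <= t -> 0 <= V t) ->
  {ae @lebesgue_measure R, forall t, 0 < t ->
     exists2 v, is_derive t 1 V v & v <= - rho * d t ^+ 2} ->
  {ae @lebesgue_measure R, forall t, 0 < t ->
     exists2 v, is_derive t 1 d v & `|v| <= K} ->
  d t @[t --> +oo] --> 0.
Proof.
move=> rho0 ACV ACd V0 dV dd.
wlog K0 : K dd / 0 < K => [W|].
  apply: (W (`|K| + 1)); last by rewrite ltr_pwDr.
  apply: filterS dd => t dd t0; have [v ? vK] := dd t0; exists v => //.
  by rewrite (le_trans vK)// (le_trans (ler_norm _))// lerDl.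
have Vni s t : 0 <= s -> s <= t -> V t <= V s.
  move=> s0 st; rewrite -subr_le0 -[0](mul0r (t - s)).
  apply: ae_growth_le => //; apply: filterS dV => r dV sr rt.
  have [v ? vd] := dV (le_lt_trans s0 sr); exists v => //.
  by rewrite (le_trans vd)// mulNr oppr_le0 mulr_ge0 ?sqr_ge0// ltW.
pose S := [set V t | t in [set t | 0 <= t]].
have Sinf : has_inf S.
  split; first by exists (V 0); exists 0 => /=.
  by exists 0 => _ [t t0 <-]; exact: V0.
apply/cvgrPdist_lt => e e0.
(* [eta] is the time a [K]-Lipschitz function needs to move by [e / 2]; [c] is the guaranteed loss
   of [V] in that time. *)
pose eta := e / (2 * K); pose c := rho * (e / 2) ^+ 2 * eta.
have eta0 : 0 < eta by rewrite divr_gt0// mulr_gt0.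
have c0 : 0 < c by rewrite mulr_gt0// mulr_gt0// exprn_gt0// divr_gt0.
have [_ [T /= T0 <-] VT] := inf_adherent c0 Sinf.
exists T; split => //= t /ltW Tt; rewrite sub0r normrN ltNge; apply/negP => ed.
have t0 : 0 <= t by exact: le_trans Tt.
have dbig s : t <= s -> s <= t + eta -> e / 2 <= `|d s|.
  move=> ts ste.
  have up : d s - d t <= K * (s - t).
    apply: ae_growth_le => //; apply: filterS dd => r dd tr rs.
    have [v ? vK] := dd (le_lt_trans t0 tr); exists v => //.
    exact: le_trans (ler_norm _) vK.
  have lo : - K * (s - t) <= d s - d t.
    apply: ae_growth_ge => //; apply: filterS dd => r dd tr rs.
    have [v ? ] := dd (le_lt_trans t0 tr); rewrite ler_norml => /andP[vK _].
    by exists v.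
  have : K * (s - t) <= e / 2.
    have -> : e / 2 = K * eta by rewrite /eta; field; lra.
    by rewrite ler_wpM2l; lra.
  have : `|d s - d t| <= K * (s - t) by rewrite ler_norml; lra.
  have := lerB_dist (d t) (d s); rewrite distrC; lra.
have : V (t + eta) - V t <= - (rho * (e / 2) ^+ 2) * (t + eta - t).
  apply: ae_growth_le => //; first by lra.
  apply: filterS dV => r dV tr rt.
  have [v ? vd] := dV (le_lt_trans t0 tr); exists v => //.
  apply: le_trans vd _; rewrite mulNr lerN2 ler_pM2l// -(real_normK (num_real (d r))).
  rewrite lerXn2r ?nnegrE//; first by rewrite divr_ge0// ltW.
  exact: dbig (ltW tr) (ltW rt).
have : inf S <= V (t + eta).
  by apply: (ge_inf Sinf.2); exists (t + eta) => //=; lra.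
have := Vni T t T0 Tt.
have -> : t + eta - t = eta by ring.
rewrite mulNr -/c; lra.
Qed.

(* Convergence along unit_window F is convergence on whole windows [t, t + 1],
   uniformly in the window, as t runs along F. *)
Definition unit_window (F : set_system R) : set_system R :=
  [set S | F [set t | forall s, t <= s -> s <= t + 1 -> S s]].

Global Instance unit_window_filter F : Filter F -> Filter (unit_window F).
Proof.
move=> FF; split.
- by apply: (@filterS _ F _ setT) => //; exact: filterT.
- move=> P Q FP FQ.
  apply: (@filterS _ F _ _ _ _ (@filterI _ F _ _ _ FP FQ)) => t [Pt Qt] s ts st.
  by split; [exact: Pt | exact: Qt].
- move=> P Q PQ; apply: (@filterS _ F) => t Pt s ts st; exact/PQ/Pt.
Qed.

Global Instance unit_window_proper F : ProperFilter F ->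
  ProperFilter (unit_window F).
Proof.
move=> PF; apply: Build_ProperFilter_ex => S FS.
by have [t tS] := @filter_ex _ F _ _ FS; exists t; apply: tS => //; rewrite lerDl.
Qed.

Lemma pinfty_unit_window F : Filter F -> pinfty_nbhs R `<=` F ->
  pinfty_nbhs R `<=` unit_window F.
Proof.
move=> FF yF S [T [Treal TS]].
apply: (@filterS _ F _ [set t | T < t]); last by apply: yF; exists T.
by move=> t /= Tt s ts _; apply: TS; exact: lt_le_trans ts.
Qed.

(** On a window of length one [f] moves by at most a bound on [|g|] there, which is arbitrarily
    small at late times; so convergence at left endpoints spreads over whole windows. *)
Lemma unit_window_cvg F f g l : ProperFilter F -> pinfty_nbhs R `<=` F ->
  (forall T, 0 < T -> abs_continuous 0 T f) ->
  {ae @lebesgue_measure R, forall t, 0 < t -> is_derive t 1 f (g t)} ->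
  g t @[t --> +oo] --> 0 -> f @ F --> l -> f @ unit_window F --> l.
Proof.
move=> PF yF ACf df g0 fl; apply/cvgrPdist_lt => e e0.
have e20 : 0 < e / 2 by rewrite divr_gt0.
move/cvgrPdist_lt : fl => /(_ _ e20) fl.
have [T [Treal Tg]] : \forall t \near +oo, `|g t| < e / 2.
  by move/cvgrPdist_lt : g0 => /(_ _ e20); apply: filterS => t; rewrite sub0r normrN.
have FT : F [set t | T < t] by apply: yF; exists T.
have F0 : F [set t | 0 < t] by apply: yF; exists 0; split => //; exact: real0.
apply: (@filterS _ F _ _ _ _ (filterI fl (filterI FT F0))) => t [/= ft [Tt t0]] s ts st1.
have up : f s - f t <= (e / 2) * (s - t).
  apply: ae_growth_le => //; first exact: ltW.
  apply: filterS df => r df tr rs; exists (g r); first by apply: df; exact: lt_trans tr.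
  by rewrite (le_trans (ler_norm _))// ltW// Tg//=; lra.
have lo : - (e / 2) * (s - t) <= f s - f t.
  apply: ae_growth_ge => //; first exact: ltW.
  apply: filterS df => r df tr rs; exists (g r); first by apply: df; exact: lt_trans tr.
  have : `|g r| < e / 2 by apply: Tg => /=; lra.
  by rewrite ltr_norml => /andP[/ltW].
move: ft; rewrite !ltr_norml => /andP[? ?]; apply/andP; split; nra.
Qed.

(** If [k] were positive, some window would have slope at least [k / 2] throughout, hence a rise of
    at least [k / 2], with both end values within [k / 4] of [l]. The set [S] admits velocity bounds
    valid only under a condition that holds on late windows. *)
Lemma unit_window_drift F f g l k (S : set R) : ProperFilter F ->
  pinfty_nbhs R `<=` F ->
  (forall T, 0 < T -> abs_continuous 0 T f) ->
  unit_window F S ->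
  {ae @lebesgue_measure R, forall t, 0 < t -> S t ->
     exists2 v, is_derive t 1 f v & g t <= v} ->
  f @ unit_window F --> l -> g @ unit_window F --> k -> k <= 0.
Proof.
move=> PF yF ACf FS df fl gk; rewrite leNgt; apply/negP => k0.
have k20 : 0 < k / 2 by rewrite divr_gt0.
have k40 : 0 < k / 4 by rewrite divr_gt0.
move/cvgrPdist_lt : fl => /(_ _ k40) fl.
move/cvgrPdist_lt : gk => /(_ _ k20) gk.
have F0 : unit_window F [set t | 0 < t].
  by apply: pinfty_unit_window => //; exists 0; split => //; exact: real0.
have [t tW] := @filter_ex _ F _ _ (filterI fl (filterI gk (filterI F0 FS))).
have [/= + [_ [/= t0 _]]] := tW t (lexx _) ltac:(lra).
have [/= + _] := tW (t + 1) ltac:(lra) (lexx _).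
have : k / 2 * (t + 1 - t) <= f (t + 1) - f t.
  apply: ae_growth_ge => //; [exact: ltW | lra |].
  apply: filterS df => r df tr rt.
  have [_ [/= gr [/= r0 Sr]]] := tW r (ltW tr) (ltW rt).
  have [v ? gv] := df r0 Sr; exists v => //.
  by apply: le_trans gv; move: gr; rewrite ltr_norml; lra.
rewrite !ltr_norml => ? /andP[? ?] /andP[? ?]; lra.
Qed.

End Asymptotics.

(** * Saddle points, optimality conditions, and dissipation *)

Section Saddle.
Variables (R : realType) (m n : nat) (c : 'cV[R]_n) (A : 'M[R]_(m, n)) (b : 'cV[R]_m).
Local Notation L := (lagrangian c A b).

Lemma lagrangianE x y : L x y = dot (A^T *m y + c) x - dot b y.
Proof.
rewrite /lagrangian dotDr dotNr dot_mulmx dotDl [dot b y]dotC; ring.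
Qed.

Lemma saddle_point_kktP x y : saddle_point L x y <->
  [/\ primal_feasible A b x, dual_feasible c A y & dot y (A *m x - b) = 0].
Proof.
split=> [[y0 sad]|[px [y0 dy] xy]].
  have stat : A^T *m y + c = 0.
    set g := A^T *m y + c.
    (* A unit gradient step lowers the Lagrangian, affine in [x], by exactly [dot g g]. *)
    have [_] := sad (x - g) y y0; rewrite !lagrangianE -/g dotDr dotNr => h.
    by apply: dot_le0_eq0; lra.
  have zero : 0 <= dot y (A *m x - b).
    have [+ _] := sad x 0 (fun j => ltac:(by rewrite mxE)).
    rewrite /lagrangian dot0l; lra.
  have px : primal_feasible A b x.
    (* Raising one multiplier by 1 changes the Lagrangian by the corresponding constraint value. *)
    move=> i; have ynn : nonneg (y + delta_mx i 0).
      by move=> j; rewrite !mxE addr_ge0.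
    have [+ _] := sad x _ ynn.
    rewrite /lagrangian dotDl.
    have -> : dot (delta_mx i 0) (A *m x - b) = (A *m x - b) i 0.
      rewrite dotE (bigD1 i)//= mxE !eqxx mul1r big1 ?addr0// => j ji.
      by rewrite mxE (negbTE ji) mul0r.
    lra.
  split=> //; apply/eqP; rewrite eq_le zero andbT dotE.
  by apply: sumr_le0 => i _; rewrite mulr_ge0_le0.
split=> // x' y' y'0; split.
  rewrite /lagrangian xy lerD2l dotE.
  by apply: sumr_le0 => i _; rewrite mulr_ge0_le0.
by rewrite !lagrangianE dy !dot0l.
Qed.

Lemma saddle_point_optimal x y : saddle_point L x y ->
  primal_optimal c A b x /\ dual_optimal c A b y.
Proof.
move=> sad; have [px dy xy] := (saddle_point_kktP x y).1 sad.
have [y0 sad'] := sad; split; split=> //.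
  move=> x' px'; have [_] := sad' x' y y0; rewrite /lagrangian xy.
  have : dot y (A *m x' - b) <= 0.
    by rewrite dotE; apply: sumr_le0 => i _; rewrite mulr_ge0_le0.
  lra.
move=> y' [y'0 dy']; have [+ _] := sad' x y' y'0.
by rewrite !lagrangianE dy' dy.2 !dot0l !sub0r.
Qed.

Variables (rho : R) (rho_gt0 : 0 < rho).
Local Notation Lh := (aug_lagrangian c A b rho).

Lemma aug_lagrangianE x xh y yh : Lh x xh y yh =
  L x y + rho / 2 * dot (x - xh) (x - xh) - rho / 2 * dot (y - yh) (y - yh).
Proof. by rewrite /aug_lagrangian /lagrangian; ring. Qed.

(** On the diagonal both quadratic terms vanish; elsewhere each has the sign that favours its own
    inequality. *)
Lemma saddle_point_aug x y : saddle_point L x y -> aug_saddle_point Lh x x y y.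
Proof.
move=> [y0 sad]; split=> // x' xh' y' yh' y'0; have [h1 h2] := sad x' y' y'0.
have nn k (u : 'cV[R]_k) : 0 <= rho / 2 * dot u u.
  by rewrite mulr_ge0 ?dot_ge0// divr_ge0// ltW.
rewrite !aug_lagrangianE !subrr !dot0l !mulr0.
have := nn _ (x' - xh'); have := nn _ (y' - yh'); lra.
Qed.

Lemma aug_saddle_point_saddle x xh y yh :
  aug_saddle_point Lh x xh y yh -> saddle_point L x y.
Proof.
move=> [y0 sad].
have r2 : 0 < rho / 2 by rewrite divr_gt0.
have ex : x - xh = 0.
  (* Moving only [xh] onto [x] removes the primal penalty, so minimality forces that penalty to be
     zero already; the dual penalty is treated likewise by maximality. *)
  apply: dot_le0_eq0; have [_] := sad x x y yh y0.
  rewrite !aug_lagrangianE !subrr !dot0l; rewrite -(pmulr_rle0 _ r2); lra.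
have ey : y - yh = 0.
  apply: dot_le0_eq0; have [+ _] := sad x x y y y0.
  rewrite !aug_lagrangianE !subrr !dot0l; rewrite -(pmulr_rle0 _ r2); lra.
split=> // x' y' y'0.
(* Diagonal test points carry no penalty, so they give the inequalities for [L] itself. *)
have [+ _] := sad x x y' y' y'0; have [_] := sad x' x' y yh y0.
by rewrite !aug_lagrangianE ex ey !subrr !dot0l; lra.
Qed.

(* Monotonicity of the saddle operator: the bilinear terms combine to
   [L p y - L x q <= 0], the coupling terms to the two squares. *)
Lemma saddle_dissipation p q x xh y yh : saddle_point L p q -> nonneg y ->
  dot (x - p) (- c - A^T *m y - rho *: (x - xh)) +
  dot (xh - p) (rho *: (x - xh)) +
  dot (y - q) (proj_pos y (A *m x - b - rho *: (y - yh))) +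
  dot (yh - q) (rho *: (y - yh)) <=
  - rho * (dot (x - xh) (x - xh) + dot (y - yh) (y - yh)).
Proof.
move=> [q0 sad] y0.
have [h1 _] := sad x y y0; have [_ h2] := sad x y y0.
have := dot_proj_pos_le (A *m x - b - rho *: (y - yh)) y0 q0.
have eL : dot (x - p) (- c - A^T *m y) + dot (y - q) (A *m x - b) = L p y - L x q.
  rewrite /lagrangian !dotDr !dotNr !dotDl !dotNl !(dot_mulmx A).
  rewrite ![dot _ c]dotC ![dot _ (A^T *m y)]dotC; ring.
rewrite ![dot _ (_ - rho *: _)]dotDr !dotNr !dotZr.
have -> : dot (x - p) (x - xh) = dot (x - xh) (x - xh) + dot (xh - p) (x - xh).
  by rewrite -dotDl addrA subrK.
have -> : dot (y - q) (y - yh) = dot (y - yh) (y - yh) + dot (yh - q) (y - yh).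
  by rewrite -dotDl addrA subrK.
lra.
Qed.

End Saddle.

(** * Bounded vector paths and their limits along filters *)

Section VectorPaths.
Variable R : realType.

Definition bounded_path k (w : R -> 'cV[R]_k) : Prop :=
  exists2 M, 0 <= M & forall t i, 0 <= t -> `|w t i 0| <= M.

Lemma bounded_path_cst k (p : 'cV[R]_k) : bounded_path (fun=> p).
Proof.
exists (\sum_i `|p i 0|) => [|_ i _]; first exact: sumr_ge0.
by rewrite (bigD1 i)//= lerDl sumr_ge0.
Qed.

Lemma bounded_pathD k (w z : R -> 'cV[R]_k) :
  bounded_path w -> bounded_path z -> bounded_path (fun t => w t + z t).
Proof.
move=> [M M0 wM] [N N0 zN]; exists (M + N) => [|t i t0]; first exact: addr_ge0.
by rewrite mxE (le_trans (ler_normD _ _))// lerD ?wM ?zN.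
Qed.

Lemma bounded_pathN k (w : R -> 'cV[R]_k) :
  bounded_path w -> bounded_path (fun t => - w t).
Proof. by move=> [M M0 wM]; exists M => // t i t0; rewrite mxE normrN wM. Qed.

Lemma bounded_path_mulmx k l (B : 'M[R]_(l, k)) (w : R -> 'cV[R]_k) :
  bounded_path w -> bounded_path (fun t => B *m w t).
Proof.
move=> [M M0 wM]; exists (\sum_i \sum_j `|B i j| * M).
  by apply: sumr_ge0 => i _; apply: sumr_ge0 => j _; rewrite mulr_ge0.
move=> t i t0; rewrite (bigD1 i)//= mxE (le_trans (ler_norm_sum _ _ _))//.
rewrite -[leLHS]addr0 lerD//.
  by apply: ler_sum => j _; rewrite normrM ler_wpM2l// wM.
by apply: sumr_ge0 => j _; apply: sumr_ge0 => j' _; rewrite mulr_ge0.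
Qed.

Lemma bounded_pathZ k (a : R) (w : R -> 'cV[R]_k) :
  bounded_path w -> bounded_path (fun t => a *: w t).
Proof.
move=> [M M0 wM]; exists (`|a| * M) => [|t i t0]; first exact: mulr_ge0.
by rewrite mxE normrM ler_wpM2l// wM.
Qed.

Lemma bounded_path_dot k (w : R -> 'cV[R]_k) p M :
  (forall t, 0 <= t -> dot (w t - p) (w t - p) <= M) -> bounded_path w.
Proof.
move=> wM; have M0 : 0 <= M by apply: le_trans (wM 0 (lexx 0)); exact: dot_ge0.
have bd : bounded_path (fun t => w t - p).
  (* [M + 1] dominates the square root of [M]. *)
  exists (M + 1) => [|t i t0]; first by rewrite addr_ge0.
  have := le_trans (sqr_coord_le_dot (w t - p) i) (wM t t0).
  rewrite -(real_normK (num_real _)); nra.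
have := bounded_pathD bd (bounded_path_cst p).
by under eq_fun do rewrite subrK.
Qed.

Lemma cvg_sum_ord k (T : Type) (F : set_system T) (FF : Filter F)
    (f : 'I_k -> T -> R) (l : 'I_k -> R) :
  (forall i, f i t @[t --> F] --> l i) ->
  \sum_(i < k) f i t @[t --> F] --> \sum_(i < k) l i.
Proof.
elim: k f l => [|k IH] f l fl.
  by under eq_fun do rewrite big_ord0; rewrite big_ord0; exact: cvg_cst.
under eq_fun do rewrite big_ord_recr/=.
rewrite big_ord_recr/=; apply: cvgD => //.
exact: (IH (fun i => f (widen_ord (leqnSn k) i))).
Qed.

Lemma cvg_dot k (T : Type) (F : set_system T) (FF : Filter F)
    (u v : T -> 'cV[R]_k) (p q : 'cV[R]_k) :
  (forall i, u t i 0 @[t --> F] --> p i 0) ->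
  (forall i, v t i 0 @[t --> F] --> q i 0) ->
  dot (u t) (v t) @[t --> F] --> dot p q.
Proof.
move=> up vq; rewrite dotE; under eq_fun do rewrite dotE.
apply: (@cvg_sum_ord _ _ _ _ (fun i t => u t i 0 * v t i 0)) => i.
exact: cvgM.
Qed.

Lemma cvg_mulmx_coord k l (T : Type) (F : set_system T) (FF : Filter F)
    (B : 'M[R]_(l, k)) (w : T -> 'cV[R]_k) (p : 'cV[R]_k) i :
  (forall j, w t j 0 @[t --> F] --> p j 0) ->
  (B *m w t) i 0 @[t --> F] --> (B *m p) i 0.
Proof.
move=> wp.
have E (z : 'cV[R]_k) : (B *m z) i 0 = dot (row i B)^T z.
  by rewrite dotE mxE; apply: eq_bigr => j _; rewrite !mxE.
rewrite E; under eq_fun do rewrite E.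
by apply: cvg_dot => // j; exact: cvg_cst.
Qed.

(** Compactness of the segment gives a cluster point, and a cluster point of the image of an
    ultrafilter is a limit. *)
Lemma ultra_bounded_cvg (F : set_system R) (f : R -> R) (M : R) : UltraFilter F ->
  F [set t | `|f t| <= M] -> exists l : R, f t @[t --> F] --> l.
Proof.
move=> UF FM.
have PF : ProperFilter (f t @[t --> F]) by exact: fmap_proper_filter.
have FI : (f t @[t --> F]) [set` `[- M, M]].
  apply: (@filterS _ F _ _ _ _ FM) => t ftM.
  by rewrite /= in_itv/= -ler_norml.
have [l [_ cl]] := segment_compact PF FI.
exists l => B lB; have [//|FB] := in_ultra_setVsetC (f @^-1` B) UF.
by have [z [/= nBz Bz]] := cl (~` B) B FB lB.
Qed.

Lemma ultra_bounded_path_cvg k (F : set_system R) (w : R -> 'cV[R]_k) :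
  UltraFilter F -> pinfty_nbhs R `<=` F -> bounded_path w ->
  exists p : 'cV[R]_k, forall i, w t i 0 @[t --> F] --> p i 0.
Proof.
move=> UF yF [M M0 wM].
have /boolp.choice[p wp] : forall i, exists l : R, w t i 0 @[t --> F] --> l.
  move=> i; apply: (@ultra_bounded_cvg _ _ M); apply: yF; exists 0.
  by split; [exact: real0 | move=> t /= t0; apply: wM; exact: ltW].
by exists (\col_i p i) => i; rewrite mxE; exact: wp.
Qed.

End VectorPaths.

(** * Energy decay, vanishing gaps, and convergence of a trajectory *)

Section Trajectory.
Variables (R : realType) (m n : nat) (c : 'cV[R]_n) (A : 'M[R]_(m, n)) (b : 'cV[R]_m).
Variables (rho : R) (rho_gt0 : 0 < rho).
Variables (x xh : R -> 'cV[R]_n) (y yh : R -> 'cV[R]_m).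
Hypothesis sol : apd_solution c A b rho x xh y yh.
Local Notation L := (lagrangian c A b).
Local Notation vx t := (- c - A^T *m y t - rho *: (x t - xh t)).
Local Notation sy t := (A *m x t - b - rho *: (y t - yh t)).

Let AC T : 0 < T -> [/\ abs_continuous 0 T x, abs_continuous 0 T xh,
  abs_continuous 0 T y & abs_continuous 0 T yh].
Proof. by case: sol => H _ _; exact: H. Qed.

Let y_nonneg t : 0 <= t -> nonneg (y t).
Proof. by case: sol => _ H _; exact: H. Qed.

Let ode : {ae @lebesgue_measure R, forall t : R, 0 < t ->
        [/\ is_derive t 1 x (vx t), is_derive t 1 xh (rho *: (x t - xh t)),
            is_derive t 1 y (proj_pos (y t) (sy t)) &
            is_derive t 1 yh (rho *: (y t - yh t))]}.
Proof. by case: sol. Qed.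

Let ACxi i T : 0 < T -> abs_continuous 0 T (fun t => x t i 0).
Proof. by move=> /AC[? ? ? ?]; exact: abs_continuous_coord. Qed.
Let ACxhi i T : 0 < T -> abs_continuous 0 T (fun t => xh t i 0).
Proof. by move=> /AC[? ? ? ?]; exact: abs_continuous_coord. Qed.
Let ACyi i T : 0 < T -> abs_continuous 0 T (fun t => y t i 0).
Proof. by move=> /AC[? ? ? ?]; exact: abs_continuous_coord. Qed.
Let ACyhi i T : 0 < T -> abs_continuous 0 T (fun t => yh t i 0).
Proof. by move=> /AC[? ? ? ?]; exact: abs_continuous_coord. Qed.

Definition energy p q (t : R) : R :=
  dot (x t - p) (x t - p) + dot (xh t - p) (xh t - p) +
  (dot (y t - q) (y t - q) + dot (yh t - q) (yh t - q)).

Lemma energy_abs_continuous p q T : 0 < T -> abs_continuous 0 T (energy p q).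
Proof.
move=> T0; have [ACx ACxh ACy ACyh] := AC T0; have T0' := ltW T0.
apply: abs_continuousD; first by apply: abs_continuousD; exact: abs_continuous_dist_sqr.
by apply: abs_continuousD; exact: abs_continuous_dist_sqr.
Qed.

Lemma energy_ge0 p q t : 0 <= energy p q t.
Proof. by rewrite /energy !addr_ge0// dot_ge0. Qed.

Lemma energy_derive p q : saddle_point L p q ->
  {ae @lebesgue_measure R, forall t : R, 0 < t ->
    exists2 v, is_derive t 1 (energy p q) v &
      v <= - (2 * rho) * (dot (x t - xh t) (x t - xh t) +
                          dot (y t - yh t) (y t - yh t))}.
Proof.
move=> sad; apply: filterS ode => t ode_t t0; have [dx dxh dy dyh] := ode_t t0.
have Ex := is_derive_dist_sqr p dx; have Exh := is_derive_dist_sqr p dxh.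
have Ey := is_derive_dist_sqr q dy; have Eyh := is_derive_dist_sqr q dyh.
eexists; first exact: (is_deriveD (is_deriveD Ex Exh) (is_deriveD Ey Eyh)).
have := saddle_dissipation rho (x t) (xh t) (yh t) sad (y_nonneg (ltW t0)).
lra.
Qed.

Lemma energy_nonincreasing p q s t : saddle_point L p q -> 0 <= s -> s <= t ->
  energy p q t <= energy p q s.
Proof.
move=> sad s0 st; rewrite -subr_le0 -[0](mul0r (t - s)).
apply: ae_growth_le => //; first exact: energy_abs_continuous.
apply: filterS (energy_derive sad) => r dE sr rt.
have [v ? vE] := dE (le_lt_trans s0 sr); exists v => //.
apply: le_trans vE _; rewrite mulNr oppr_le0; apply: mulr_ge0.
  by apply: mulr_ge0 => //; exact: ltW.
exact: addr_ge0 (dot_ge0 _) (dot_ge0 _).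
Qed.

Lemma trajectory_bounded p q : saddle_point L p q ->
  [/\ bounded_path x, bounded_path xh, bounded_path y & bounded_path yh].
Proof.
move=> sad.
have bd t : 0 <= t -> energy p q t <= energy p q 0 by exact: energy_nonincreasing.
have nn k (u : 'cV[R]_k) := dot_ge0 u.
split; [apply: (@bounded_path_dot _ _ _ p (energy p q 0))
  | apply: (@bounded_path_dot _ _ _ p (energy p q 0))
  | apply: (@bounded_path_dot _ _ _ q (energy p q 0))
  | apply: (@bounded_path_dot _ _ _ q (energy p q 0))] => t /bd; apply: le_trans;
  rewrite /energy; have := nn _ (x t - p); have := nn _ (xh t - p);
  have := nn _ (y t - q); have := nn _ (yh t - q); lra.
Qed.

(** Barbalat's argument applies: the energy dissipates at least [2 * rho] times the squared gap
    coordinate, and the velocity of the gap is bounded because the trajectory is. *)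
Lemma primal_gap_cvg0 p q i : saddle_point L p q ->
  x t i 0 - xh t i 0 @[t --> +oo] --> 0.
Proof.
move=> sad; have [bx bxh by_ byh] := trajectory_bounded sad.
have [K K0 wK] : bounded_path (fun t => vx t - rho *: (x t - xh t)).
  do ?[apply: bounded_pathD | apply: bounded_pathN | apply: bounded_pathZ
     | apply: bounded_path_mulmx | exact: bounded_path_cst] => //.
apply: (@barbalat _ (energy p q) _ (2 * rho) K).
- by rewrite mulr_gt0.
- exact: energy_abs_continuous.
- by move=> T T0; apply: abs_continuousD; [exact: ACxi | apply: abs_continuousN; exact: ACxhi].
- by move=> t _; exact: energy_ge0.
- apply: filterS (energy_derive sad) => t dE t0; have [v ? vE] := dE t0.
  exists v => //; apply: le_trans vE _.
  rewrite !mulNr lerN2 ler_pM2l ?mulr_gt0//.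
  have := sqr_coord_le_dot (x t - xh t) i; rewrite !mxE.
  have := dot_ge0 (y t - yh t); lra.
- apply: filterS ode => t ode_t t0; have [dx dxh _ _] := ode_t t0.
  exists ((vx t - rho *: (x t - xh t)) i 0); last exact: wK (ltW t0).
  have := is_derive_coord i 0 (is_deriveB dx dxh).
  by rewrite (_ : (fun s => (x - xh) s i 0) = (fun s => x s i 0 - xh s i 0))//;
    apply/funext => s; rewrite !mxE.
Qed.

Lemma dual_gap_cvg0 p q i : saddle_point L p q ->
  y t i 0 - yh t i 0 @[t --> +oo] --> 0.
Proof.
move=> sad; have [bx bxh by_ byh] := trajectory_bounded sad.
(* The projected velocity is controlled by the unprojected one, coordinate by coordinate, so only
   the latter has to be bounded. *)
have [K1 K10 wK1] : bounded_path (fun t => sy t).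
  do ?[apply: bounded_pathD | apply: bounded_pathN | apply: bounded_pathZ
     | apply: bounded_path_mulmx | exact: bounded_path_cst] => //.
have [K2 K20 wK2] : bounded_path (fun t => rho *: (y t - yh t)).
  do ?[apply: bounded_pathD | apply: bounded_pathN | apply: bounded_pathZ
     | apply: bounded_path_mulmx | exact: bounded_path_cst] => //.
apply: (@barbalat _ (energy p q) _ (2 * rho) (K1 + K2)).
- by rewrite mulr_gt0.
- exact: energy_abs_continuous.
- by move=> T T0; apply: abs_continuousD; [exact: ACyi | apply: abs_continuousN; exact: ACyhi].
- by move=> t _; exact: energy_ge0.
- apply: filterS (energy_derive sad) => t dE t0; have [v ? vE] := dE t0.
  exists v => //; apply: le_trans vE _.
  rewrite !mulNr lerN2 ler_pM2l ?mulr_gt0//.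
  have := sqr_coord_le_dot (y t - yh t) i; rewrite !mxE.
  have := dot_ge0 (x t - xh t); lra.
- apply: filterS ode => t ode_t t0; have [_ _ dy dyh] := ode_t t0.
  exists ((proj_pos (y t) (sy t) - rho *: (y t - yh t)) i 0).
    have := is_derive_coord i 0 (is_deriveB dy dyh).
    by rewrite (_ : (fun s => (y - yh) s i 0) = (fun s => y s i 0 - yh s i 0))//;
      apply/funext => s; rewrite !mxE.
  rewrite mxE (le_trans (ler_normD _ _))// lerD//.
    exact: le_trans (norm_proj_pos_le _ _ _) (wK1 t i (ltW t0)).
  by rewrite mxE normrN; exact: wK2 (ltW t0).
Qed.


(* If y_j has a positive limit then the projection is eventually inactive, so
   its velocity must vanish in the limit; otherwise it only bounds s_j. *)
Lemma window_limit_saddle F (p : 'cV[R]_n) (q : 'cV[R]_m) :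
  ProperFilter F -> pinfty_nbhs R `<=` F ->
  (forall i, x t i 0 @[t --> unit_window F] --> p i 0) ->
  (forall i, xh t i 0 @[t --> unit_window F] --> p i 0) ->
  (forall j, y t j 0 @[t --> unit_window F] --> q j 0) ->
  (forall j, yh t j 0 @[t --> unit_window F] --> q j 0) ->
  saddle_point L p q.
Proof.
move=> PF yF xp xhp yq yhq; apply/saddle_point_kktP.
have pos : unit_window F [set t | 0 < t].
  by apply: pinfty_unit_window => //; exists 0; split => //; exact: real0.
have q0 : nonneg q.
  move=> j; apply: cvgr_to_ge (yq j) _.
  by apply: (@filterS _ (unit_window F) _ _ _ _ pos) => t /= t0; exact: y_nonneg (ltW t0) _.
have cB k (u v : 'cV[R]_k) i : (u - v) i 0 = u i 0 - v i 0 by rewrite !mxE.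
have cN k (u : 'cV[R]_k) i : (- u) i 0 = - u i 0 by rewrite mxE.
have cZ k a (u : 'cV[R]_k) i : (a *: u) i 0 = a * u i 0 by rewrite mxE.
have vxW i : vx t i 0 @[t --> unit_window F] --> (- c - A^T *m q) i 0.
  have -> : (- c - A^T *m q) i 0 = - c i 0 - (A^T *m q) i 0 - rho * (p i 0 - p i 0).
    by rewrite subrr mulr0 subr0 !(cB, cN).
  rewrite (_ : (fun t => vx t i 0) =
    (fun t => - c i 0 - (A^T *m y t) i 0 - rho * (x t i 0 - xh t i 0))); last first.
    by apply/funext => t; rewrite !(cB, cN, cZ).
  apply: cvgB; first by apply: cvgB; [exact: cvg_cst | exact: cvg_mulmx_coord].
  by apply: cvgM; [exact: cvg_cst | exact: cvgB].
have syW j : sy t j 0 @[t --> unit_window F] --> (A *m p - b) j 0.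
  have -> : (A *m p - b) j 0 = (A *m p) j 0 - b j 0 - rho * (q j 0 - q j 0).
    by rewrite subrr mulr0 subr0 !(cB, cN).
  rewrite (_ : (fun t => sy t j 0) =
    (fun t => (A *m x t) j 0 - b j 0 - rho * (y t j 0 - yh t j 0))); last first.
    by apply/funext => t; rewrite !(cB, cN, cZ).
  apply: cvgB; first by apply: cvgB; [exact: cvg_mulmx_coord | exact: cvg_cst].
  by apply: cvgM; [exact: cvg_cst | exact: cvgB].
(* The primal velocity is unprojected, so applying the drift lemma to [x] and to [- x] makes its
   limit vanish. *)
have vx_le i : (- c - A^T *m q) i 0 <= 0.
  apply: (unit_window_drift PF yF (@ACxi i) pos _ (xp i) (vxW i)).
  apply: filterS ode => t ode_t t0 _; have [dx _ _ _] := ode_t t0.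
  by exists (vx t i 0); first exact: is_derive_coord.
have vx_ge i : - (- c - A^T *m q) i 0 <= 0.
  apply: (unit_window_drift PF yF _ pos _ (cvgN (xp i)) (cvgN (vxW i))).
    by move=> T T0; apply: abs_continuousN; exact: ACxi.
  apply: filterS ode => t ode_t t0 _; have [dx _ _ _] := ode_t t0.
  by exists (- vx t i 0); first exact: is_deriveN (is_derive_coord i 0 dx).
have feas : primal_feasible A b p.
  move=> j.
  apply: (unit_window_drift PF yF (@ACyi j) pos _ (yq j) (syW j)).
  apply: filterS ode => t ode_t t0 _; have [_ _ dy _] := ode_t t0.
  exists (proj_pos (y t) (sy t) j 0); first exact: is_derive_coord.
  by rewrite [leRHS]mxE; case: ifP => // _; rewrite le_max lexx.
split=> //.
  split=> //; apply/colP => i; have := vx_le i; have := vx_ge i; rewrite !mxE; lra.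
rewrite dotE; apply: big1 => j _.
have := q0 j; rewrite le_eqVlt => /orP[/eqP<-|qj]; first by rewrite mul0r.
suff -> : (A *m p - b) j 0 = 0 by rewrite mulr0.
apply/le_anti; rewrite feas/= -oppr_le0.
have ypos : unit_window F [set t | 0 < y t j 0].
  exact: (cvgr_gt _ (yq j)).
apply: (unit_window_drift PF yF _ ypos _ (cvgN (yq j)) (cvgN (syW j))).
  by move=> T T0; apply: abs_continuousN; exact: ACyi.
apply: filterS ode => t ode_t t0 /= yt; have [_ _ dy _] := ode_t t0.
exists (- sy t j 0) => //.
have := is_derive_coord j 0 dy; rewrite [X in is_derive _ _ _ X]mxE yt.
exact: is_deriveN.
Qed.

Lemma energy_window_cvg0 F (p : 'cV[R]_n) (q : 'cV[R]_m) : ProperFilter F ->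
  (forall i, x t i 0 @[t --> F] --> p i 0) ->
  (forall i, xh t i 0 @[t --> F] --> p i 0) ->
  (forall j, y t j 0 @[t --> F] --> q j 0) ->
  (forall j, yh t j 0 @[t --> F] --> q j 0) ->
  energy p q t @[t --> F] --> 0.
Proof.
move=> PF xp xhp yq yhq.
have cv0 k (w : R -> 'cV[R]_k) (r : 'cV[R]_k) : (forall i, w t i 0 @[t --> F] --> r i 0) ->
    dot (w t - r) (w t - r) @[t --> F] --> 0.
  move=> wr; rewrite -(dot0l (0 : 'cV[R]_k)).
  have wr0 i : (w t - r) i 0 @[t --> F] --> (0 : 'cV[R]_k) i 0.
    rewrite mxE -(subrr (r i 0)).
    rewrite (_ : (fun t => (w t - r) i 0) = (fun t => w t i 0 - r i 0)).
      by apply: cvgB => //; exact: cvg_cst.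
    by apply/funext => t; rewrite !mxE.
  exact: cvg_dot.
have <- : 0 + 0 + (0 + 0) = 0 :> R by rewrite !addr0.
by apply: cvgD; apply: cvgD; exact: cv0.
Qed.

Lemma energy_cvg0_limits p q : energy p q t @[t --> +oo] --> 0 ->
  [/\ x t @[t --> +oo] --> p, xh t @[t --> +oo] --> p,
      y t @[t --> +oo] --> q & yh t @[t --> +oo] --> q].
Proof.
move=> E0.
have cv k (w : R -> 'cV[R]_k) (r : 'cV[R]_k) :
    (forall t, dot (w t - r) (w t - r) <= energy p q t) -> w t @[t --> +oo] --> r.
  move=> wE; apply/cvgrPdist_le => e e0;
  have e20 : 0 < e ^+ 2 by rewrite exprn_gt0.
  move/cvgrPdist_lt : E0 => /(_ _ e20); apply: filterS => t.
  rewrite sub0r normrN => Et; rewrite distrC; apply: dot_le_sqr_norm; first exact: ltW.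
  exact: le_trans (wE t) (le_trans (ler_norm _) (ltW Et)).
by split; apply: cv => t; rewrite /energy;
  have := dot_ge0 (x t - p); have := dot_ge0 (xh t - p);
  have := dot_ge0 (y t - q); have := dot_ge0 (yh t - q); lra.
Qed.

Lemma trajectory_cvg p0 q0 : saddle_point L p0 q0 ->
  exists p q, saddle_point L p q /\
    [/\ x t @[t --> +oo] --> p, xh t @[t --> +oo] --> p,
        y t @[t --> +oo] --> q & yh t @[t --> +oo] --> q].
Proof.
(* An ultrafilter of late times replaces the extraction of subsequences: all bounded coordinates
   converge along it at once. *)
move=> sad0; have [F [UF yF]] := @ultraFilterLemma _ (pinfty_nbhs R) _.
have PF : ProperFilter F by exact: ultra_proper.
have [_ bxh _ byh] := trajectory_bounded sad0.
have [p xhF] := ultra_bounded_path_cvg UF yF bxh.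
have [q yhF] := ultra_bounded_path_cvg UF yF byh.
have yW := pinfty_unit_window _ yF.
have gapW (f : R -> R) : f t @[t --> +oo] --> 0 -> f t @[t --> unit_window F] --> 0.
  by move=> f0 B /f0; exact: yW.
have rho_cvg0 (f : R -> R) : f t @[t --> +oo] --> 0 -> rho * f t @[t --> +oo] --> 0.
  by move=> f0; rewrite -(mulr0 rho); apply: cvgM => //; exact: cvg_cst.
(* The auxiliary variables come first, since their velocity is [rho] times a vanishing gap; [x] and
   [y] then inherit the limits through the gaps. *)
have xhW i : xh t i 0 @[t --> unit_window F] --> p i 0.
  apply: (unit_window_cvg PF yF (@ACxhi i) _ (rho_cvg0 _ (primal_gap_cvg0 i sad0)) (xhF i)).
  apply: filterS ode => t ode_t t0; have [_ dxh _ _] := ode_t t0.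
  by have := is_derive_coord i 0 dxh; rewrite !mxE.
have yhW j : yh t j 0 @[t --> unit_window F] --> q j 0.
  apply: (unit_window_cvg PF yF (@ACyhi j) _ (rho_cvg0 _ (dual_gap_cvg0 j sad0)) (yhF j)).
  apply: filterS ode => t ode_t t0; have [_ _ _ dyh] := ode_t t0.
  by have := is_derive_coord j 0 dyh; rewrite !mxE.
have addW (f g : R -> R) (l : R) : f t - g t @[t --> +oo] --> 0 ->
    g t @[t --> unit_window F] --> l -> f t @[t --> unit_window F] --> l.
  move=> /gapW fg gl; have <- : 0 + l = l by rewrite add0r.
  rewrite (_ : f = (fun t => (f t - g t) + g t)); first exact: cvgD.
  by apply/funext => t; rewrite subrK.
have xW i := addW _ _ _ (primal_gap_cvg0 i sad0) (xhW i).
have yW' j := addW _ _ _ (dual_gap_cvg0 j sad0) (yhW j).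
have sad := window_limit_saddle PF yF xW xhW yW' yhW.
exists p, q; split=> //; apply: energy_cvg0_limits.
apply/cvgrPdist_lt => e e0.
have : energy p q t @[t --> unit_window F] --> 0 by exact: energy_window_cvg0.
move/cvgrPdist_lt => /(_ _ e0) Ee.
have pos : unit_window F [set t | 0 < t].
  by apply: yW; exists 0; split => //; exact: real0.
(* A single time of small energy suffices, because the energy relative to the saddle point [(p, q)]
   is nonincreasing. *)
have [t [/= Et t0]] := filter_ex (filterI Ee pos).
exists t; split => //= s /ltW ts.
have := energy_nonincreasing sad (ltW t0) ts; have := energy_ge0 p q s.
move: Et; rewrite !sub0r !normrN !ger0_norm ?energy_ge0//; lra.
Qed.

End Trajectory.

(** * Global convergence and optimality of the limits *)

Theorem mainTheorem16 (R : realType) (m n : nat) (c : 'cV[R]_n)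
    (A : 'M[R]_(m, n)) (b : 'cV[R]_m) (rho : R)
    (rho_gt0 : 0 < rho)
    (saddle_ex : exists (x0 : 'cV[R]_n) (y0 : 'cV[R]_m),
       saddle_point (lagrangian c A b) x0 y0) :
  (forall (x xh : R -> 'cV[R]_n) (y yh : R -> 'cV[R]_m),
     apd_solution c A b rho x xh y yh ->
     exists (xs xhs : 'cV[R]_n) (ys yhs : 'cV[R]_m),
       [/\ x t @[t --> +oo] --> xs, xh t @[t --> +oo] --> xhs,
           y t @[t --> +oo] --> ys & yh t @[t --> +oo] --> yhs] /\
       aug_saddle_point (aug_lagrangian c A b rho) xs xhs ys yhs) /\
  (forall (xs xhs : 'cV[R]_n) (ys yhs : 'cV[R]_m),
     aug_saddle_point (aug_lagrangian c A b rho) xs xhs ys yhs ->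
     saddle_point (lagrangian c A b) xs ys /\
     (primal_optimal c A b xs /\ dual_optimal c A b ys)).
Proof.
split=> [x xh y yh sol|xs xhs ys yhs aug].
  have [x0 [y0 sad0]] := saddle_ex.
  have [p [q [sad lims]]] := trajectory_cvg rho_gt0 sol sad0.
  by exists p, p, q, q; split=> //; exact: saddle_point_aug.
have sad := aug_saddle_point_saddle rho_gt0 aug.
by split=> //; exact: saddle_point_optimal.
Qed.
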